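(* Let $\Gamma$ be a non-elementary word-hyperbolic group, $(M,d)$ a proper geodesic metric space, and $\rho:\Gamma\to\mathrm{LHomeo}(M)$ an action expanding at a non-empty compact invariant subset $\Lambda\subset M$, no point of which is isolated in $M$. Suppose there exists an equivariant continuous nowhere constant map $f:\Lambda\to\partial_\infty\Gamma$ to the Gromov boundary of $\Gamma$. Then the action $\rho$ is S-hyperbolic (and thus meandering-hyperbolic) at $\Lambda$, and $f$ equals the postal map $\pi:\Lambda\to\partial_\infty\Gamma$ of $\rho$.
   Context: A map between topological spaces is nowhere constant if the image of every non-empty open subset is not a singleton. A hyperbolic group is non-elementary if it has no cyclic subgroup of finite index. Conventions: $\mathbb N_0=\{0,1,2,\dots\}$, $\mathbb N=\{1,2,\dots\}$; $B_r(x)$ is the open $r$-ball, $N_r(\Lambda)$ the open $r$-neighborhood. A metric space is proper if its closed balls are compact, geodesic if any two points are joined by an isometrically embedded interval. $\mathrm{LHomeo}(M)$ is the group of homeomorphisms of $M$ whose restrictions to compact subsets are bi-Lipschitz. Expansion. Let $f$ be a homeomorphism of $M$, $\lambda>1$, $U\subset M$, $\delta>0$. $f$ is $(\lambda,U)$-expanding if $d(f(x),f(y))\ge\lambda d(x,y)$ for all $x,y\in U$; it is $(\lambda,U;\delta)$-expanding if moreover $B_{\lambda\eta}(f(x))\subset f(B_\eta(x))$ whenever $B_\eta(x)\subset U$ and $\eta\le\delta$. For an open cover $\mathcal U$ of $\Lambda$, $\delta_{\mathcal U}$ is the supremum of its Lebesgue numbers (numbers $\delta>0$ such that for every $x\in\Lambda$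 the ball $B_\delta(x)$ lies in a member of $\mathcal U$). An action $\rho$ with non-empty compact invariant subset $\Lambda$, no point of which is isolated in $M$, is expanding at $\Lambda$ if there are a finite index set $\mathcal I$, a cover $\mathcal U=\{U_i\mid i\in\mathcal I\}$ of $\Lambda$ by open (possibly empty) subsets of $M$, a map $\mathcal I\to\Gamma$, $i\mapsto s_i$, and real numbers $L\ge\lambda>1$ and $0<\delta\le\delta_{\mathcal U}$ such that for each $i$ the map $\rho(s_i^{-1})$ is $L$-Lipschitz on $N_\delta(\Lambda)$ and $(\lambda,U_i;\delta)$-expanding, and $\Sigma=\{s_i\mid i\in\mathcal I\}$ is a symmetric generating set of $\Gamma$. Then $\mathcal D=(\mathcal I,\mathcal U,\Sigma,\delta,L,\lambda)$ is an expansion datum of $\rho$; $d_\Sigma$ is the word metric on $\Gamma$. Codes and rays. Let $x\in\Lambda$, $0<\eta\le\delta$. For $\alpha:\mathbb N_0\to\mathcal I$ put $p_0=x$, $p_{k+1}=\rho(s_{\alpha(k)}^{-1})(p_k)$. $\alpha$ is a $(\mathcal D,\eta)$-code for $x$ if $B_\eta(p_k)\subset U_{\alpha(k)}$ for every $k\in\mathbb N$ (nothing is required for $k=0$). Its ray is $c^\alpha:\mathbb N_0\to\Gamma$, $c^\alpha_k=s_{\alpha(0)}s_{\alpha(1)}\cdots s_{\alpha(k)}$. $\mathrm{Ray}_x(\mathcal D,\eta)$ is the set of rays of all $(\mathcal D,\eta)$-codes for $x$. S-hyperbolicity. $\rho$ is S-hyperbolic at $\Lambda$ (with datum $(\mathcal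 D;N)$) if it has an expansion datum $\mathcal D$ and there is an integer $N\ge1$ such that for every $x\in\Lambda$ the images of any two rays in $\mathrm{Ray}_x(\mathcal D,\delta)$ are within Hausdorff distance $N$ from each other in $(\Gamma,d_\Sigma)$. Meandering hyperbolicity. For expansion data $\mathcal D_k=(\mathcal I_k,\mathcal U_k,\Sigma_k,\delta_k,L_k,\lambda_k)$, $k=0,1$, write $\mathcal D_0\prec\mathcal D_1$ if $\mathcal I_0\subset\mathcal I_1$, $U_{0,i}\subset U_{1,i}$ and $s_{0,i}=s_{1,i}$ for all $i\in\mathcal I_0$, $\delta_0>\delta_1$, $L_0\le L_1$, $\lambda_0\ge\lambda_1$. Write $c^\alpha\approx^N_{(\mathcal D,\eta)}c^\beta$ for rays in $\mathrm{Ray}_x(\mathcal D,\eta)$ if there are infinite $P,Q\subset\mathbb N_0$ with $\{c^\alpha_k\}_{k\in P}$ and $\{c^\beta_j\}_{j\in Q}$ within Hausdorff distance $N$ in $(\Gamma,d_\Sigma)$; $(\mathcal D,\eta;N)$-equivalence is the equivalence relation on $\mathrm{Ray}_x(\mathcal D,\eta)$ it generates. $\rho$ is meandering-hyperbolic at $\Lambda$ with datum $(\mathcal D_0\prec\mathcal D;N)$, $N\ge1$, if for every $x\in\Lambda$ all rays in $\mathrm{Ray}_x(\mathcal D_0,\delta_0)$ are $(\mathcal D,\delta;N)$-equivalent. (An S-hyperbolic action with datum $(\mathcal D_0;N)$ is meandering-hyperbolic: take $\mathcal D$ equal to $\mathcal D_0$ with $\delta_0$ replaced by a smaller number.) Postal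 map. All rays $c^\alpha$ are quasigeodesic rays in $(\Gamma,d_\Sigma)$. For hyperbolic $\Gamma$ and $\rho$ meandering-hyperbolic with datum $(\mathcal D_0\prec\mathcal D;N)$, the postal map $\pi:\Lambda\to\partial_\infty\Gamma$ sends $x$ to the point of $\partial_\infty\Gamma$ represented by a ray $c^\alpha\in\mathrm{Ray}_x(\mathcal D_0,\delta_0)$; this is independent of the choice of the ray. *)

(* Defs.v *)
From HB Require Import structures.
From Stdlib Require Import Relations.Relation_Operators.
From mathcomp Require Import all_boot all_order all_algebra.
From mathcomp Require Import all_classical all_reals all_analysis.

Set Implicit Arguments.
Unset Strict Implicit.
Unset Printing Implicit Defensive.

Import Order.TTheory GRing.Theory Num.Theory.

Local Open Scope classical_set_scope.
Local Open Scope ring_scope.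
Local Open Scope quotient_scope.

Section WordMetric.
Variable G : groupType.
Implicit Types (S : set G) (g h : G).

Definition word_product S (n : nat) : set G :=
  [set g | exists w : seq G,
     [/\ size w = n, forall s, s \in w -> S s & g = (\prod_(s <- w) s)%g]].

Definition symmetric_generating S : Prop :=
  (forall s, S s -> S (s^-1)%g) /\
  (forall g, exists n, word_product S n g).

(* The value is meaningful only for g in the submonoid generated by S; the junk
   value 0 elsewhere never occurs when S is a symmetric generating set. *)
Definition word_length S g : nat :=
  match pselect (exists n, `[< word_product S n g >]) with
  | left ex => ex_minn ex
  | right _ => 0%N
  end.

Definition word_dist S g h : nat := word_length S (g^-1 * h)%g.

(* Hausdorff distance at most N: distances are natural numbers, so the
   distance from a point to a nonempty set is attained. *)
Definition hausdorff_le S (N : nat) (A B : set G) : Prop :=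
  (forall a, A a -> exists2 b, B b & (word_dist S a b <= N)%N) /\
  (forall b, B b -> exists2 a, A a & (word_dist S b a <= N)%N).

End WordMetric.

Record generating_set (G : groupType) := GeneratingSet {
  gens :> set G;
  gens_finite : finite_set gens;
  gens_generating : symmetric_generating gens
}.

Section Hyperbolicity.
Variable G : groupType.

Definition gromov_product (S : set G) (o x y : G) : rat :=
  ((word_dist S o x)%:R + (word_dist S o y)%:R - (word_dist S x y)%:R) / 2%:R.

Definition word_hyperbolic (S : set G) : Prop :=
  exists delta : rat, forall o x y z : G,
    Num.min (gromov_product S o x y) (gromov_product S o y z) - delta
      <= gromov_product S o x z.

Definition cyclic_subgroup (g : G) : set G :=
  [set h | exists n : nat, h = (g ^+ n)%g \/ h = (g ^- n)%g].

Definition finite_index (H : set G) : Prop :=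
  finite_set (range (fun x : G => [set (x * h)%g | h in H])).

Definition non_elementary : Prop :=
  forall g : G, ~ finite_index (cyclic_subgroup g).

End Hyperbolicity.

Section WordMetricTheory.
Variables (G : groupType) (S : set G).
Hypothesis genS : symmetric_generating S.

Lemma word_length_word g : word_product S (word_length S g) g.
Proof.
rewrite /word_length; case: pselect => [ex|nex].
  by case: ex_minnP => n /asboolP.
by case: nex; have [n ng] := genS.2 g; exists n; apply/asboolP.
Qed.

Lemma word_length_le n g : word_product S n g -> (word_length S g <= n)%N.
Proof.
move=> ng; rewrite /word_length; case: pselect => // ex.
by case: ex_minnP => m _; apply; apply/asboolP.
Qed.

Lemma word_length1 : word_length S 1%g = 0%N.
Proof.
by apply/eqP; rewrite -leqn0; apply: word_length_le; exists [::]; rewrite big_nil.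
Qed.

Lemma word_lengthM g h :
  (word_length S (g * h)%g <= word_length S g + word_length S h)%N.
Proof.
apply: word_length_le.
have [v [sv vS gv]] := word_length_word g.
have [w [sw wS hw]] := word_length_word h.
exists (v ++ w); split; first by rewrite size_cat sv sw.
  by move=> s; rewrite mem_cat => /orP[/vS|/wS].
by rewrite big_cat/= -gv -hw.
Qed.

Lemma word_distxx g : word_dist S g g = 0%N.
Proof. by rewrite /word_dist mulVg word_length1. Qed.

Lemma word_dist_triangle h g k :
  (word_dist S g k <= word_dist S g h + word_dist S h k)%N.
Proof.
rewrite /word_dist; have -> : (g^-1 * k = g^-1 * h * (h^-1 * k))%g.
  by rewrite -mulgA mulVKg.
exact: word_lengthM.
Qed.

Lemma word_distMl k g h : word_dist S (k * g)%g (k * h)%g = word_dist S g h.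
Proof. by rewrite /word_dist invgM -mulgA mulKg. Qed.

Lemma hausdorff_le_refl A : hausdorff_le S 0 A A.
Proof. by split=> a Aa; exists a; rewrite ?word_distxx. Qed.

Lemma hausdorff_le_sym N A B : hausdorff_le S N A B -> hausdorff_le S N B A.
Proof. by case. Qed.

Lemma hausdorff_le_trans N P A B C :
  hausdorff_le S N A B -> hausdorff_le S P B C -> hausdorff_le S (N + P) A C.
Proof.
move=> [AB BA] [BC CB]; split=> [a /AB[b /BC[c Cc bc] ab]|c /CB[b /BA[a Aa ba] cb]].
  by exists c => //; rewrite (leq_trans (word_dist_triangle b _ _))// leq_add.
by exists a => //; rewrite (leq_trans (word_dist_triangle b _ _))// addnC leq_add.
Qed.

End WordMetricTheory.

(* The Gromov boundary: geodesic rays in (G, d_S), with arbitrary starting point,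
   up to finite Hausdorff distance.  Rays carry the topology of pointwise
   convergence, G being discrete, and the boundary the quotient topology; since
   rays with a given starting point form an open and closed set of rays, this
   is the usual topology defined with a base point when G is hyperbolic. *)
Section GromovBoundary.
Variables (G : groupType) (S : generating_set G).

Definition geodesic_rays : set {ptws nat -> discrete_topology G} :=
  [set c | forall m n : nat, word_dist S (c m) (c (m + n)%N) = n].

Definition geodesic_ray : Type := set_type geodesic_rays.
HB.instance Definition _ := Topological.on geodesic_ray.

Definition ray_val (c : geodesic_ray) : nat -> G := \val c.

Definition asymptotic : rel geodesic_ray := fun c c' =>
  `[< exists N, hausdorff_le S N (range (ray_val c)) (range (ray_val c')) >].

Let genS := gens_generating S.

Lemma asymptotic_refl : reflexive asymptotic.
Proof. by move=> c; apply/asboolP; exists 0%N; exact: hausdorff_le_refl. Qed.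

Lemma asymptotic_sym : symmetric asymptotic.
Proof.
move=> c c'.
by apply/asboolP/asboolP => -[N /hausdorff_le_sym cc']; exists N.
Qed.

Lemma asymptotic_trans : transitive asymptotic.
Proof.
move=> c2 c1 c3 /asboolP[N c12] /asboolP[P c23].
by apply/asboolP; exists (N + P)%N; exact: (hausdorff_le_trans genS c12 c23).
Qed.

Canonical asymptotic_equiv :=
  EquivRel asymptotic asymptotic_refl asymptotic_sym asymptotic_trans.

Definition boundary : Type := quotient_topology {eq_quot asymptotic_equiv}.
HB.instance Definition _ := Topological.on boundary.

Definition boundary_point (c : geodesic_ray) : boundary :=
  \pi_({eq_quot asymptotic_equiv}) c.

Lemma boundary_point_eq (c c' : geodesic_ray) :
  boundary_point c = boundary_point c' <-> asymptotic c c'.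
Proof. by split => [/eqmodP|cc']; last apply/eqmodP. Qed.

Lemma translate_subproof (g : G) (c : geodesic_ray) :
  (fun n => (g * ray_val c n)%g) \in geodesic_rays.
Proof.
by apply/mem_set => m n; rewrite word_distMl; have /set_mem := valP c; apply.
Qed.

Definition translate (g : G) (c : geodesic_ray) : geodesic_ray :=
  exist (fun c => c \in geodesic_rays) _ (translate_subproof g c).

Definition boundary_act (g : G) (xi : boundary) : boundary :=
  boundary_point (translate g (repr (xi : {eq_quot asymptotic_equiv}))).

Lemma boundary_actE (g : G) (c : geodesic_ray) :
  boundary_act g (boundary_point c) = boundary_point (translate g c).
Proof.
apply/boundary_point_eq; set r := repr _.
have /boundary_point_eq/asboolP[N [rc cr]] : boundary_point r = boundary_point c.
  exact: reprK.
apply/asboolP; exists N; split.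
  move=> _ [n _ <-]; have [_ [m _ <-] d] := rc (ray_val r n) (ex_intro2 _ _ n I erefl).
  by exists (g * ray_val c m)%g; [exists m|rewrite word_distMl].
move=> _ [n _ <-]; have [_ [m _ <-] d] := cr (ray_val c n) (ex_intro2 _ _ n I erefl).
by exists (g * ray_val r m)%g; [exists m|rewrite word_distMl].
Qed.

(* When G is hyperbolic every quasigeodesic ray c represents a point. *)
Definition represents (c : nat -> G) (xi : boundary) : Prop :=
  exists r : geodesic_ray, boundary_point r = xi /\
    exists N, hausdorff_le S N (range c) (range (ray_val r)).

Lemma represents_unique (c : nat -> G) (xi xi' : boundary) :
  represents c xi -> represents c xi' -> xi = xi'.
Proof.
move=> [r [<- [N cr]]] [r' [<- [N' cr']]]; apply/boundary_point_eq/asboolP.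
by exists (N + N')%N; exact: (hausdorff_le_trans genS (hausdorff_le_sym cr) cr').
Qed.

End GromovBoundary.

Section MetricSpaces.
Variables (R : realType) (M : metricType R).

(* The closed balls are written out because closed_ball is the closure of the
   open ball, which may be smaller. *)
Definition proper_space : Prop :=
  forall (x : M) (r : R), compact [set y | mdist x y <= r].

Definition geodesic_space : Prop :=
  forall x y : M, exists gamma : R -> M,
    [/\ gamma 0 = x, gamma (mdist x y) = y &
        forall s t, 0 <= s <= mdist x y -> 0 <= t <= mdist x y ->
          mdist (gamma s) (gamma t) = `|s - t|].

Definition lipschitz_dist (L : R) (A : set M) (phi : M -> M) : Prop :=
  forall x y, A x -> A y -> mdist (phi x) (phi y) <= L * mdist x y.

Definition bilipschitz_dist (A : set M) (phi : M -> M) : Prop :=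
  exists2 L : R, 0 < L &
    forall x y, A x -> A y ->
      L^-1 * mdist x y <= mdist (phi x) (phi y) <= L * mdist x y.

Definition is_homeo (phi : M -> M) : Prop :=
  continuous phi /\
  exists psi : M -> M, [/\ cancel phi psi, cancel psi phi & continuous psi].

Definition is_LHomeo (phi : M -> M) : Prop :=
  is_homeo phi /\ forall K : set M, compact K -> bilipschitz_dist K phi.

Definition expanding_map (lambda : R) (U : set M) (phi : M -> M) : Prop :=
  forall x y, U x -> U y -> lambda * mdist x y <= mdist (phi x) (phi y).

Definition expanding_map_at (lambda : R) (U : set M) (delta : R)
    (phi : M -> M) : Prop :=
  expanding_map lambda U phi /\
  forall (x : M) (eta : R), 0 < eta <= delta -> ball x eta `<=` U ->
    ball (phi x) (lambda * eta) `<=` phi @` ball x eta.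

Definition open_neighborhood (delta : R) (A : set M) : set M :=
  \bigcup_(x in A) ball x delta.

Definition lebesgue_number (I : Type) (A : set M) (U : I -> set M)
    (delta : R) : Prop :=
  0 < delta /\ forall x, A x -> exists i, ball x delta `<=` U i.

(* Possibly +oo. *)
Definition sup_lebesgue (I : Type) (A : set M) (U : I -> set M) : \bar R :=
  ereal_sup [set delta%:E | delta in lebesgue_number A U].

End MetricSpaces.

Definition nowhere_constant_on (X Y : topologicalType) (A : set X)
    (f : X -> Y) : Prop :=
  forall U : set X, open U -> A `&` U !=set0 ->
    forall y : Y, f @` (A `&` U) <> [set y].

Record expansion_data (R : realType) (M : metricType R) (G : groupType) :=
  ExpansionData {
    ed_index : finType;
    ed_cover : ed_index -> set M;
    ed_gen : ed_index -> G;
    ed_delta : R;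
    ed_L : R;
    ed_lambda : R
  }.
Arguments ed_cover {R M G} e i.
Arguments ed_gen {R M G} e i.

Section Actions.
Variables (R : realType) (M : metricType R) (G : groupType).
Variables (rho : G -> M -> M) (Lam : set M).
Implicit Types (D : expansion_data M G) (x : M) (eta : R) (c : nat -> G).

Definition LHomeo_action : Prop :=
  [/\ forall g, is_LHomeo (rho g),
      forall x, rho 1%g x = x &
      forall g h x, rho (g * h)%g x = rho g (rho h x)].

Definition invariant_set : Prop := forall g, rho g @` Lam = Lam.

Definition ed_Sigma D : set G := range (ed_gen D).

Definition is_expansion_datum D : Prop :=
  [/\ forall i, open (ed_cover D i),
      Lam `<=` \bigcup_i ed_cover D i,
      1 < ed_lambda D <= ed_L D,
      0 < ed_delta D /\ ((ed_delta D)%:E <= sup_lebesgue Lam (ed_cover D))%E &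
      (forall i : ed_index D,
         lipschitz_dist (ed_L D) (open_neighborhood (ed_delta D) Lam)
           (rho (ed_gen D i)^-1%g) /\
         expanding_map_at (ed_lambda D) (ed_cover D i) (ed_delta D)
           (rho (ed_gen D i)^-1%g)) /\
      symmetric_generating (ed_Sigma D)].

Definition expanding_at : Prop := exists D, is_expansion_datum D.

Fixpoint code_point D (alpha : nat -> ed_index D) x (k : nat) : M :=
  match k with
  | 0 => x
  | k'.+1 => rho (ed_gen D (alpha k'))^-1%g (code_point alpha x k')
  end.

Definition is_code D eta x (alpha : nat -> ed_index D) : Prop :=
  forall k : nat, (1 <= k)%N ->
    ball (code_point alpha x k) eta `<=` ed_cover D (alpha k).

Definition code_ray D (alpha : nat -> ed_index D) : nat -> G :=
  fun k => (\prod_(j < k.+1) ed_gen D (alpha j))%g.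

Definition Ray D eta x : set (nat -> G) :=
  [set c | exists2 alpha : nat -> ed_index D,
     is_code eta x alpha & c = code_ray alpha].

Definition S_hyperbolic_datum D (N : nat) : Prop :=
  [/\ is_expansion_datum D, (1 <= N)%N &
      forall x, Lam x -> forall c c',
        Ray D (ed_delta D) x c -> Ray D (ed_delta D) x c' ->
        hausdorff_le (ed_Sigma D) N (range c) (range c')].

Definition S_hyperbolic_at : Prop := exists D N, S_hyperbolic_datum D N.

(* Index sets are types, so the inclusion of index sets becomes an injection. *)
Definition ed_prec D0 D1 : Prop :=
  [/\ exists2 j : ed_index D0 -> ed_index D1, injective j &
        forall i, ed_cover D0 i `<=` ed_cover D1 (j i) /\
                  ed_gen D0 i = ed_gen D1 (j i),
      ed_delta D1 < ed_delta D0,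
      ed_L D0 <= ed_L D1 &
      ed_lambda D1 <= ed_lambda D0].

Definition ray_close D eta (N : nat) x c c' : Prop :=
  [/\ Ray D eta x c, Ray D eta x c' &
      exists P Q : set nat, [/\ infinite_set P, infinite_set Q &
        hausdorff_le (ed_Sigma D) N (c @` P) (c' @` Q)]].

Definition ray_equivalent D eta (N : nat) x c c' : Prop :=
  [/\ Ray D eta x c, Ray D eta x c' &
      clos_refl_sym_trans (nat -> G) (ray_close D eta N x) c c'].

Definition meandering_hyperbolic_datum D0 D (N : nat) : Prop :=
  [/\ is_expansion_datum D0, is_expansion_datum D, ed_prec D0 D, (1 <= N)%N &
      forall x, Lam x -> forall c c',
        Ray D0 (ed_delta D0) x c -> Ray D0 (ed_delta D0) x c' ->
        ray_equivalent D (ed_delta D) N x c c'].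

Definition meandering_hyperbolic_at : Prop :=
  exists D0 D N, meandering_hyperbolic_datum D0 D N.

(* The defining property of the postal map of a meandering-hyperbolic datum
   (D0, D, N), which involves D0 only; it determines p on Lam, as a ray
   represents at most one point of the boundary. *)
Definition is_postal_map (S : generating_set G) D0 (p : M -> boundary S) : Prop :=
  forall x, Lam x ->
    (exists c, Ray D0 (ed_delta D0) x c) /\
    (forall c, Ray D0 (ed_delta D0) x c -> represents c (p x)).

Definition equivariant_on (S : generating_set G) (f : M -> boundary S) : Prop :=
  forall g x, Lam x -> f (rho g x) = boundary_act g (f x).

End Actions.

(* Main.v *)
Require Import Defs.
From Stdlib Require Import Relations.Relation_Operators.
From mathcomp Require Import all_boot all_order all_algebra.
From mathcomp Require Import all_classical all_reals all_analysis.
From mathcomp Require Import zify lra.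

(* Let c be the ray of a code of x, with code points p_k.  Backward iteration
   of the expansion shrinks balls: c_k maps the delta-ball around p_{k+1} into
   any given neighborhood of x once k is large.  As f is nowhere constant and
   Lam is compact, the f-image of that ball contains two points whose Gromov
   product is bounded independently of k; by equivariance and continuity, c_k
   maps them close to f x.  A geodesic joining these two image points passes
   near c_k, so c_k converges to f x.  On the other hand c is a uniform
   quasigeodesic: a segment of n letters expands distances near a code point
   by lambda^n, while a group element of word length l distorts them by at
   most L^l, whence lambda^n <= L^l since the points of Lam are not isolated.
   The stability of quasigeodesics then puts c within bounded distance of every
   geodesic ray ending at f x, and of the rays of all other codes of x within
   a distance that depends neither on the codes nor on x. *)

Set Implicit Arguments.
Unset Strict Implicit.
Unset Printing Implicit Defensive.

Import Order.TTheory GRing.Theory Num.Theory.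

(** * Quasigeodesics in hyperbolic spaces with an integral distance *)

Lemma linear_leq_exp2 (A : nat) :
  exists n, forall k, n <= k -> A * k.+1 <= 2 ^ k.
Proof.
exists (4 * A) => k kA; have lt2 := ltn_expl k./2 (isT : 1 < 2).
have h : (2 ^ k./2) ^ 2 <= 2 ^ k by rewrite -expnM leq_exp2l//; lia.
apply: leq_trans h; rewrite -mulnn; nia.
Qed.

Section Hyperbolic.
Variables (X : Type) (d : X -> X -> nat) (D : nat).
Hypothesis dxx : forall x, d x x = 0.
Hypothesis dC : forall x y, d x y = d y x.
Hypothesis dT : forall x y z, d x z <= d x y + d y z.

(* Twice the Gromov product; the subtraction never truncates. *)
Definition gprod o x y := d o x + d o y - d x y.

Hypothesis hyp : forall o x y z,
  minn (gprod o x y) (gprod o y z) <= gprod o x z + D.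
Hypothesis geod : forall x y, exists2 g : nat -> X, g 0 = x /\ g (d x y) = y &
  forall i j, i <= j <= d x y -> d (g i) (g j) = j - i.

Lemma gprodC o x y : gprod o x y = gprod o y x.
Proof. by rewrite /gprod addnC (dC x y). Qed.

Lemma gprod_basepoint o o' x y : gprod o x y <= gprod o' x y + 2 * d o o'.
Proof.
have := dT o o' x; have := dT o o' y; have := dT x o' y.
by rewrite /gprod (dC x o'); lia.
Qed.

Lemma gprod_move o x x' y : gprod o x y <= gprod o x' y + 2 * d x x'.
Proof.
have := dT o x x'; have := dT o x' x; have := dT x' x y; have := dT x' o y.
rewrite /gprod (dC x' o) (dC x' x); lia.
Qed.

(** Bisecting the chain costs one [D] per halving, so the loss is only logarithmic in the number of
    steps. *)
Lemma gprod_chain k R o (u : nat -> X) n : 0 < n <= 2 ^ k ->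
  (forall i, i < n -> R <= gprod o (u i) (u i.+1)) ->
  R <= gprod o (u 0) (u n) + k * D.
Proof.
elim: k u n => [|k IH] u n.
  by case: n => [|[|n]]// _ /(_ 0 isT); lia.
have [->|n1] := eqVneq n 1; first by move=> _ /(_ 0 isT); lia.
rewrite expnS => n2 uR.
have IH1 := IH u n./2 ltac:(lia) (fun i ni => uR i ltac:(lia)).
have := IH (fun i => u (n./2 + i)) (n - n./2) ltac:(lia).
rewrite addn0 subnKC ?leq_half//; last by lia.
have h := hyp o (u 0) (u n./2) (u n).
have /[swap] /[apply] : forall i, i < n - n./2 ->
    R <= gprod o (u (n./2 + i)) (u (n./2 + i.+1)).
  by move=> i ni; rewrite addnS; apply: uR; lia.
by lia.
Qed.

(** Go along [g] from [x] by [d o x]: the Gromov products of that point with [x] and with [y] are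
    both at least its distance to [o]. If [g] is shorter than this, [y] will do. *)
Lemma near_geodesic o x y (g : nat -> X) : g 0 = x -> g (d x y) = y ->
  (forall i j, i <= j <= d x y -> d (g i) (g j) = j - i) ->
  exists2 t, t <= d x y & d o (g t) <= gprod o x y + D.
Proof.
move=> g0 g1 gE.
have [oxy|oxy] := leqP (d o x) (d x y); last first.
  by exists (d x y) => //; rewrite g1 /gprod; lia.
exists (d o x) => //; set z := g _.
have xz : d x z = d o x by have := gE 0 (d o x); rewrite g0 -/z subn0 => ->.
have zy : d z y = d x y - d o x.
  by have := gE (d o x) (d x y); rewrite g1 -/z oxy leqnn => ->.
by have := hyp o x z y; have := dT x o y; rewrite /gprod (dC x o); lia.
Qed.

Definition quasigeodesic B Q (c : nat -> X) :=
  forall i j, i <= j ->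
    d (c i) (c j) <= B * (j - i) /\ j - i <= Q * d (c i) (c j).

(* With [o] the point of the geodesic at maximal distance [H] from [c], go along
   the geodesic from [o] by [2 * H] on both sides (or to its ends), then across
   to [c]: the part of [c] in between has length linear in [H], stays outside
   the [H]-ball around [o], and so contradicts [gprod_chain] for [H] large. *)
Lemma geodesic_near_quasigeodesic B Q : exists H, forall c n (g : nat -> X),
  quasigeodesic B Q c ->
  g 0 = c 0 -> g (d (c 0) (c n)) = c n ->
  (forall i j, i <= j <= d (c 0) (c n) -> d (g i) (g j) = j - i) ->
  forall t, t <= d (c 0) (c n) -> exists2 i, i <= n & d (g t) (c i) <= H.
Proof.
have [k1 k1P] := linear_leq_exp2 (6 * Q * D.+1).
exists (B + 2 * D + k1 * D.+1) => c n g qc; set l := d _ _ => g0 gl gE.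
pose near_c t := [arg min_(i < (ord0 : 'I_n.+1)) d (g t) (c i)].
have near_cP t (i : 'I_n.+1) : d (g t) (c (near_c t)) <= d (g t) (c i).
  by rewrite /near_c; case: arg_minnP => // j _; apply.
pose t0 := [arg max_(t > (ord0 : 'I_l.+1)) d (g t) (c (near_c t))].
pose H := d (g t0) (c (near_c t0)).
have HP t : t <= l -> d (g t) (c (near_c t)) <= H.
  move=> tl; rewrite /H /t0; case: arg_maxnP => // j _.
  by move=> /(_ (Ordinal (tl : t < l.+1)) isT).
suff Hle : H <= B + 2 * D + k1 * D.+1.
  move=> t tl; exists (near_c t); first by rewrite -ltnS ltn_ord.
  exact: leq_trans (HP t tl) Hle.
set o := g t0.
have oP i : i <= n -> H <= d o (c i).
  by move=> ni; apply: near_cP (Ordinal (ni : i < n.+1)).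
have t0l : t0 <= l by rewrite -ltnS.
(* If [t0 - 2 * H] truncates to 0, the end [c 0] serves. Otherwise [c a] is at most [H] from the
   geodesic point and at least [H] from [o]. *)
have [a an [da ga]] : exists2 a, a <= n &
    d (g (t0 - 2 * H)) (c a) <= H /\ 2 * H <= gprod o (g (t0 - 2 * H)) (c a).
  have [ht|ht] := leqP (2 * H) t0.
    have nb : near_c (t0 - 2 * H) <= n by rewrite -ltnS.
    exists (near_c (t0 - 2 * H)) => //; have h := HP (t0 - 2 * H) ltac:(lia).
    split=> //; have e : d o (g (t0 - 2 * H)) = 2 * H by rewrite dC gE; lia.
    by have := oP _ nb; rewrite /gprod e; lia.
  exists 0 => //; have -> : t0 - 2 * H = 0 by lia.
  by rewrite g0 dxx; split=> //; rewrite /gprod dxx; have := oP 0 isT; lia.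
have [b bn [db gb]] : exists2 b, b <= n &
    d (g (minn l (t0 + 2 * H))) (c b) <= H /\
    2 * H <= gprod o (c b) (g (minn l (t0 + 2 * H))).
  have [ht|ht] := leqP (t0 + 2 * H) l.
    have nb : near_c (t0 + 2 * H) <= n by rewrite -ltnS.
    exists (near_c (t0 + 2 * H)) => //; have h := HP (t0 + 2 * H) ltac:(lia).
    split=> //; have e : d o (g (t0 + 2 * H)) = 2 * H by rewrite gE; lia.
    by have := oP _ nb; rewrite /gprod (dC (c _) (g _)) e; lia.
  exists n => //; rewrite gl dxx; split=> //.
  by rewrite /gprod dxx; have := oP n (leqnn n); lia.
have zero : gprod o (g (t0 - 2 * H)) (g (minn l (t0 + 2 * H))) = 0.
  by rewrite /gprod (dC o) /o !gE; lia.
have dab : d (c a) (c b) <= 6 * H.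
  have := dT (c a) (g (t0 - 2 * H)) (c b).
  have := dT (g (t0 - 2 * H)) (g (minn l (t0 + 2 * H))) (c b).
  by rewrite (dC (c a) (g _)) gE; lia.
have jump i : i < n -> 2 * H - B <= gprod o (c i) (c i.+1).
  move=> ni; have [+ _] := qc i i.+1 (leqnSn i); rewrite subSnn muln1.
  by have := oP i (ltnW ni); have := oP i.+1 ni; rewrite /gprod; lia.
have key k i j : i <= j <= n -> d (c i) (c j) <= 6 * H -> 6 * Q * H <= 2 ^ k ->
    2 * H - B <= gprod o (c i) (c j) + k * D.
  move=> /andP[ij jn] dij hk.
  have [<-|nij] := eqVneq i j.
    by have := oP i ltac:(lia); rewrite /gprod dxx; lia.
  have := @gprod_chain k (2 * H - B) o (fun m => c (i + m)) (j - i).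
  rewrite addn0 subnKC//; apply.
    by have [_] := qc i j ij; nia.
  by move=> m mj; rewrite addnS; apply: jump; lia.
rewrite leqNgt; apply/negP => ltH.
(* For this [k] the loss [k * D] is at most [H], while [2 ^ k] exceeds the chain length [6 * Q * H],
   as [ltH] forces [k1 <= k]. *)
pose k := H %/ D.+1.
have kH : H < k.+1 * D.+1 by rewrite /k; exact: ltn_ceil.
have kH' : k * D.+1 <= H by exact: leq_divM.
have hk : 6 * Q * H <= 2 ^ k by apply: leq_trans (k1P k _); nia.
have : 2 * H - B <= gprod o (c a) (c b) + k * D.
  by have [ab|/ltnW ba] := leqP a b; [|rewrite gprodC];
    apply: key; rewrite ?ab ?ba//= dC.
have h1 := hyp o (g (t0 - 2 * H)) (c a) (g (minn l (t0 + 2 * H))).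
have h2 := hyp o (c a) (c b) (g (minn l (t0 + 2 * H))).
nia.
Qed.

(** The converse half of Morse stability. Take the last point of the geodesic close to some [c i]
    with [i <= k]; the next point, or the end, is close to some [c j] with [k <= j]. Then [j - i] is
    bounded, so [c k] is near the geodesic. *)
Lemma quasigeodesic_gprod B Q : exists K, forall c n k,
  quasigeodesic B Q c -> k <= n -> gprod (c k) (c 0) (c n) <= K.
Proof.
have [H HP] := geodesic_near_quasigeodesic B Q.
exists (2 * (H + B * (Q * (2 * H).+1))) => c n k qc kn.
have [g [g0 gl] gE] := geod (c 0) (c n).
have {}HP := HP c n g qc g0 gl gE.
set l := d (c 0) (c n) in HP gl gE.
suff [t tl dt] : exists2 t, t <= l & d (c k) (g t) <= H + B * (Q * (2 * H).+1).
  have : d (g t) (c 0) + d (g t) (c n) = l.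
    by rewrite dC -{1}g0 -gl !gE; lia.
  have := dT (c k) (g t) (c 0); have := dT (c k) (g t) (c n).
  by rewrite /gprod -/l; lia.
pose P t := (t <= l) && [exists i : 'I_n.+1, (i <= k) && (d (g t) (c i) <= H)].
have exP : exists t, P t.
  by exists 0; rewrite /P/=; apply/existsP; exists ord0; rewrite /= g0 dxx.
have ubP t : P t -> t <= l by case/andP.
case: (ex_maxnP exP ubP) => t /andP[tl /existsP[i /andP[ik di]]] tmax.
exists t => //.
have [j [jn kj jt]] : exists j, [/\ j <= n, k <= j & d (g t) (c j) <= H.+1].
  have [tl'|lt] := ltnP t l; last first.
    by exists n; rewrite kn; have -> : t = l; [lia|rewrite gl dxx].
  have [j jn dj] := HP t.+1 tl'; exists j; split=> //.
    rewrite leqNgt; apply/negP => jk; suff /tmax : P t.+1 by rewrite ltnn.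
    rewrite /P tl'; apply/existsP.
    by exists (Ordinal (jn : j < n.+1)) => /=; lia.
  by have := dT (g t) (g t.+1) (c j); rewrite gE; lia.
have [_ ij] := qc i j ltac:(lia); have [dik _] := qc i k ik.
have := dT (c i) (g t) (c j); have := dT (c k) (c i) (g t).
rewrite (dC (c i) (g t)) (dC (c k) (c i)) => h1 h2.
have : k - i <= Q * (2 * H).+1 by nia.
by nia.
Qed.

(** Only some late pairs need a large Gromov product; for quasigeodesics this already gives fellow
    travelling. *)
Definition frequently_close o (c c' : nat -> X) := forall R n0,
  exists m n, [/\ n0 <= m, n0 <= n & R <= gprod o (c m) (c' n)].

(** Seen from [c k], the pair [c 0], [c m] has a bounded product and the pair [c m], [c' n] a large
    one, so [c 0], [c' n] has a bounded one. Hence [c k] is near a geodesic from [c' 0] to [c' n],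
    and so near [c']. *)
Lemma quasigeodesic_fellow B Q E o : exists N, forall c c',
  quasigeodesic B Q c -> quasigeodesic B Q c' -> d (c 0) (c' 0) <= E ->
  frequently_close o c c' ->
  forall k, exists j, d (c k) (c' j) <= N.
Proof.
have [H HP] := geodesic_near_quasigeodesic B Q.
have [K KP] := quasigeodesic_gprod B Q.
exists (H + (K + D + 2 * E + D)) => c c' qc qc' cc' conv k.
(* [2 * d o (c k)] pays for moving the base point from [o] to [c k]; the rest exceeds [K + D]. *)
have [m [n [km _ R]]] := conv (2 * d o (c k) + K + D).+1 k.
have h1 := KP c m k qc km.
have h2 := hyp (c k) (c 0) (c' n) (c m).
have h3 := gprod_basepoint o (c k) (c' n) (c m).
have h4 : gprod (c k) (c 0) (c' n) <= K + D by move: R; rewrite gprodC; lia.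
have h5 := gprod_move (c k) (c' 0) (c 0) (c' n).
have [g [g0 gl] gE] := geod (c' 0) (c' n).
have [t tl dt] := near_geodesic (c k) g0 gl gE.
have [i _ di] := HP c' n g qc' g0 gl gE t tl.
exists i; have := dT (c k) (g t) (c' i); rewrite (dC (c' 0)) in h5; lia.
Qed.

Definition geodesic_seq (c : nat -> X) := forall m n, d (c m) (c (m + n)) = n.

Lemma geodesic_seq_dist c m n :
  geodesic_seq c -> m <= n -> d (c m) (c n) = n - m.
Proof. by move=> gc mn; rewrite -{1}(subnKC mn) gc. Qed.

Lemma geodesic_seq_quasigeodesic B Q c :
  0 < B -> 0 < Q -> geodesic_seq c -> quasigeodesic B Q c.
Proof. by move=> B0 Q0 gc i j ij; rewrite geodesic_seq_dist//; nia. Qed.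

Lemma gprod_geodesic_seq o c m n : geodesic_seq c ->
  2 * minn m n <= gprod o (c m) (c n) + 2 * d o (c 0).
Proof.
move=> gc; wlog mn : m n / m <= n.
  move=> wl; have /orP[mn|nm] := leq_total m n; first exact: wl.
  by rewrite minnC gprodC wl.
have := gprod_basepoint (c 0) o (c m) (c n); rewrite (dC (c 0) o).
by rewrite {1}/gprod !geodesic_seq_dist//; lia.
Qed.

Lemma frequently_closeC o c c' :
  frequently_close o c c' -> frequently_close o c' c.
Proof.
move=> h R n0; have [m [n [nm nn mn]]] := h R n0.
by exists n, m; rewrite gprodC.
Qed.

Definition eventually_gprod R o (c c' : nat -> X) :=
  exists n0, forall m n, n0 <= m -> n0 <= n -> R <= gprod o (c m) (c' n).

Lemma eventually_gprod_trans R R' o c c' c'' :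
  eventually_gprod R o c c' -> eventually_gprod R' o c' c'' ->
  eventually_gprod (minn R R' - D) o c c''.
Proof.
move=> [n1 h1] [n2 h2]; exists (maxn n1 n2) => m n nm nn.
have := h1 m (maxn n1 n2) ltac:(lia) ltac:(lia).
have := h2 (maxn n1 n2) n ltac:(lia) ltac:(lia).
by have := hyp o (c m) (c' (maxn n1 n2)) (c'' n); lia.
Qed.

Lemma frequently_close_fellow B Q o c c' :
  quasigeodesic B Q c -> quasigeodesic B Q c' -> frequently_close o c c' ->
  exists N, forall k, exists j, d (c k) (c' j) <= N.
Proof.
move=> qc qc' cc'.
have [N NP] := quasigeodesic_fellow B Q (d (c 0) (c' 0)) o.
by exists N; exact: NP.
Qed.

Lemma fellow_eventually_gprod N o c c' :
  geodesic_seq c -> geodesic_seq c' ->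
  (forall k, exists j, d (c k) (c' j) <= N) ->
  forall R, eventually_gprod R o c c'.
Proof.
move=> gc gc' cc' R.
exists (R + 3 * N + d (c 0) (c' 0) + 2 * d o (c' 0)) => m n nm nn.
have [j mj] := cc' m; have := gprod_move o (c' j) (c m) (c' n).
rewrite (dC (c' j)); have := gprod_geodesic_seq o j n gc'.
have : m <= d (c 0) (c' 0) + j + N.
  have := dT (c 0) (c' 0) (c m); have := dT (c' 0) (c' j) (c m).
  rewrite (geodesic_seq_dist gc (leq0n m)) (geodesic_seq_dist gc' (leq0n j)).
  by rewrite (dC (c' j)); lia.
lia.
Qed.

(* If [u] and [v] are seen from [p] in different directions but from [o] in
   the same direction, then [p] lies in that direction from [o]. *)
Lemma gprod_between o p u v C : gprod p u v <= C ->
  gprod o u v <= gprod o p u + C.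
Proof.
have := dT u p v; have := dT o p u; have := dT o p v.
have := dT p o u; have := dT p o v; have := dT u o v; have := dT o u p.
by rewrite /gprod (dC p o) (dC u p) (dC u o); lia.
Qed.

End Hyperbolic.

(** * Word metrics and the Gromov boundary *)

Local Open Scope classical_set_scope.
Local Open Scope quotient_scope.

Section WordMetric.
Variables (G : groupType) (S : set G).
Hypothesis genS : symmetric_generating S.
Local Notation d := (word_dist S).

Lemma word_productM m n g h :
  word_product S m g -> word_product S n h -> word_product S (m + n) (g * h)%g.
Proof.
move=> [v [sv vS gv]] [w [sw wS hw]]; exists (v ++ w); split.
- by rewrite size_cat sv sw.
- by move=> s; rewrite mem_cat => /orP[/vS|/wS].
- by rewrite big_cat/= -gv -hw.
Qed.

Lemma word_product_gen s : S s -> word_product S 1 s.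
Proof.
by move=> Ss; exists [:: s]; split; rewrite ?big_seq1// => t /[!inE] /eqP->.
Qed.

Lemma word_productV n g : word_product S n g -> word_product S n (g^-1)%g.
Proof.
move=> [w [<- wS ->]]; elim: w wS => [|s w IH] wS.
  by rewrite big_nil invg1; exists [::]; rewrite big_nil.
rewrite big_cons invgM /= -addn1; apply: word_productM.
  by apply: IH => t tw; apply: wS; rewrite inE tw orbT.
by apply: word_product_gen; apply: genS.1; apply: wS; rewrite mem_head.
Qed.

Lemma word_lengthV g : word_length S (g^-1)%g = word_length S g.
Proof.
apply/eqP; rewrite eqn_leq -{3}(invgK g).
by rewrite !word_length_le//; apply: word_productV; exact: word_length_word.
Qed.

Lemma word_distC g h : d g h = d h g.
Proof. by rewrite /word_dist -word_lengthV invgM invgK. Qed.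

(** Follow the prefixes of a shortest word: subwords bound the distances from above, and by the
    triangle inequality a strict inequality would shorten the whole. *)
Lemma word_dist_geodesic x y :
  exists2 g : nat -> G, g 0%N = x /\ g (d x y) = y &
  forall i j, (i <= j <= d x y)%N -> d (g i) (g j) = (j - i)%N.
Proof.
have [w [sw wS xyw]] := word_length_word genS (x^-1 * y)%g.
pose g i := (x * \prod_(s <- take i w) s)%g.
have g0 : g 0%N = x by rewrite /g take0 big_nil mulg1.
have gl : g (d x y) = y by rewrite /g /word_dist -sw take_size -xyw mulVKg.
exists g => // i j /andP[ij jl].
have step a b : (a <= b <= d x y)%N -> (d (g a) (g b) <= b - a)%N.
  move=> /andP[ab bl]; rewrite /g word_distMl; apply: word_length_le.
  exists (drop a (take b w)); split.
  - by rewrite size_drop size_takel// sw.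
  - by move=> s /mem_drop/mem_take/wS.
  - have -> : take a w = take a (take b w) by rewrite take_takel.
    by rewrite -{2}(cat_take_drop a (take b w)) big_cat/= mulKg.
have h1 := step 0%N i ltac:(lia); have h2 := step i j ltac:(lia).
have h3 := step j (d x y) ltac:(lia).
have h4 := word_dist_triangle genS (g i) (g 0%N) (g (d x y)).
have h5 := word_dist_triangle genS (g j) (g i) (g (d x y)).
by rewrite g0 gl in h1 h3 h4 h5; lia.
Qed.

Lemma word_hyperbolic_gprod : word_hyperbolic S ->
  exists D, forall o x y z,
    (minn (gprod d o x y) (gprod d o y z) <= gprod d o x z + D)%N.
Proof.
move=> [e he]; exists (Num.bound `|(2 * e)%R|) => o x y z.
have eD : (2 * e < (Num.bound `|(2 * e)%R|)%:R)%R.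
  by apply: le_lt_trans (ler_norm _) _; apply: archi_boundP.
have gE u v : ((gprod d o u v)%:R = 2 * gromov_product S o u v)%R.
  rewrite /gprod natrB ?natrD /gromov_product; last first.
    by rewrite [d o u]word_distC; exact: word_dist_triangle.
  by lra.
rewrite -(ler_nat rat) natrD; have := he o x y z; have := gE x z.
have := gE x y; have := gE y z.
have [h|h] := leqP (gprod d o x y) (gprod d o y z); move: h;
  rewrite -?(ler_nat rat) -?(ltr_nat rat) => h h1 h2 h3.
  rewrite min_l; lra.
rewrite min_r; lra.
Qed.

End WordMetric.

Lemma finite_bounded (G : groupType) (A : set G) (F : G -> nat) :
  finite_set A -> exists B, forall g, A g -> (F g <= B)%N.
Proof.
move=> /finite_seqP[s ->]; exists (\max_(g <- s) F g) => g gs.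
by apply: leq_bigmax_seq.
Qed.

(** The boundary is built on [S] while rays of codes are measured in [Sigma]; this bound, used in
    both directions, converts between the two. *)
Lemma word_length_bound (G : groupType) (S T : set G) :
  symmetric_generating S -> symmetric_generating T -> finite_set S ->
  exists2 B, (0 < B)%N & forall g, (word_length T g <= B * word_length S g)%N.
Proof.
move=> gS gT fS; have [B BP] := finite_bounded (word_length T) fS.
exists B.+1 => // g; have [w [<- wS ->]] := word_length_word gS g.
elim: w wS => [|s w IH] wS; first by rewrite big_nil word_length1.
rewrite big_cons /= mulnS; apply: leq_trans (word_lengthM gT _ _) _.
apply: leq_add; first by apply: leq_trans (leqnSn B); apply/BP/wS/mem_head.
by apply: IH => t tw; apply: wS; rewrite inE tw orbT.
Qed.

Lemma hausdorff_le_fellow (G : groupType) (S : set G) N (c c' : nat -> G) :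
  (forall k, exists j, (word_dist S (c k) (c' j) <= N)%N) ->
  (forall k, exists j, (word_dist S (c' k) (c j) <= N)%N) ->
  hausdorff_le S N (range c) (range c').
Proof.
move=> cc' c'c; split=> _ [k _ <-].
  by have [j h] := cc' k; exists (c' j).
by have [j h] := c'c k; exists (c j).
Qed.

(** * Closeness of boundary points and the quotient topology *)

Section Boundary.
Variables (G : groupType) (S : generating_set G) (D : nat).
Local Notation d := (word_dist S).
Local Notation gp := (gprod d).
Hypothesis hypS : forall o x y z : G,
  (minn (gp o x y) (gp o y z) <= gp o x z + D)%N.

Let genS : symmetric_generating S := gens_generating S.
Let dxx := @word_distxx G S.
Let dC := word_distC genS.
Let dT x y z := word_dist_triangle genS y x z.
Let geod := word_dist_geodesic genS.

Implicit Types (r : geodesic_ray S) (xi zeta : boundary S).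

Lemma ray_valP r : geodesic_seq d (ray_val r).
Proof. by have /set_mem := valP r. Qed.

Lemma boundary_pointP xi : exists r, boundary_point r = xi.
Proof.
by exists (repr (xi : {eq_quot (asymptotic_equiv S)})); exact: reprK.
Qed.

Lemma frequently_close_hausdorff B Q o (c c' : nat -> G) :
  quasigeodesic d B Q c -> quasigeodesic d B Q c' ->
  frequently_close d o c c' ->
  exists N, hausdorff_le S N (range c) (range c').
Proof.
move=> qc qc' cc'.
have [N NP] := frequently_close_fellow dxx dC dT hypS geod qc qc' cc'.
have [N' NP'] := frequently_close_fellow dxx dC dT hypS geod qc' qc
  (frequently_closeC dC cc').
exists (maxn N N'); apply: hausdorff_le_fellow => k.
  by have [j] := NP k; exists j; lia.
by have [j] := NP' k; exists j; lia.
Qed.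

Lemma frequently_close_boundary_point r r' :
  frequently_close d 1%g (ray_val r) (ray_val r') ->
  boundary_point r = boundary_point r'.
Proof.
move=> rr'; apply/boundary_point_eq/asboolP.
by apply: (frequently_close_hausdorff _ _ rr');
  apply: (geodesic_seq_quasigeodesic (isT : 0 < 1)%N (isT : 0 < 1)%N);
  exact: ray_valP.
Qed.

Lemma boundary_point_eventually_gprod r r' R :
  boundary_point r = boundary_point r' ->
  eventually_gprod d R 1%g (ray_val r) (ray_val r').
Proof.
move=> /boundary_point_eq/asboolP[N [rr' _]].
suff h k : exists j, (d (ray_val r k) (ray_val r' j) <= N)%N.
  exact: (fellow_eventually_gprod dC dT 1%g (ray_valP r) (ray_valP r') h).
by have [|_ [j _ <-] h] := rr' (ray_val r k); [exists k|exists j].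
Qed.

(* Twice the Gromov product at [1] of the two boundary points is at least [R],
   up to an additive constant depending on the representing rays. *)
Definition boundary_close R xi zeta := exists r r',
  [/\ boundary_point r = xi, boundary_point r' = zeta &
      eventually_gprod d R 1%g (ray_val r) (ray_val r')].

Lemma boundary_close_le m n xi zeta :
  (m <= n)%N -> boundary_close n xi zeta -> boundary_close m xi zeta.
Proof.
move=> mn [r [r' [rx rz [n0 h]]]]; exists r, r'; split=> //.
exists n0 => i j ni nj; exact: leq_trans mn (h _ _ ni nj).
Qed.

Lemma boundary_close_refl R xi : boundary_close R xi xi.
Proof.
have [r <-] := boundary_pointP xi.
by exists r, r; split=> //; exact: boundary_point_eventually_gprod.
Qed.

Lemma boundary_close_rays R xi zeta r r' : boundary_close (R + 2 * D) xi zeta ->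
  boundary_point r = xi -> boundary_point r' = zeta ->
  eventually_gprod d R 1%g (ray_val r) (ray_val r').
Proof.
move=> [s [s' [<- <- ss']]] rs r's'.
have h1 := boundary_point_eventually_gprod (R + 2 * D) rs.
have h2 := boundary_point_eventually_gprod (R + 2 * D) (esym r's').
have := eventually_gprod_trans hypS (eventually_gprod_trans hypS h1 ss') h2.
by move=> [n0 h]; exists n0 => m n nm nn; have := h m n nm nn; lia.
Qed.

(** The two relations may use different rays for [eta]: adjusting the first costs [2 * D], and
    composing costs another [D]. *)
Lemma boundary_close_trans R xi eta zeta :
  boundary_close (R + 3 * D) xi eta -> boundary_close (R + D) eta zeta ->
  boundary_close R xi zeta.
Proof.
move=> xe [s [s' [se <- ss']]]; have [r rx] := boundary_pointP xi.
exists r, s'; split=> //.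
have xe' : boundary_close (R + D + 2 * D) xi eta by rewrite -addnA -mulSn.
have h := boundary_close_rays xe' rx se.
have [n0 h0] := eventually_gprod_trans hypS h ss'.
by exists n0 => m n nm nn; have := h0 m n nm nn; lia.
Qed.

Lemma boundary_close_inj xi zeta :
  (forall R, boundary_close R xi zeta) -> xi = zeta.
Proof.
have [r <-] := boundary_pointP xi; have [r' <-] := boundary_pointP zeta => h.
apply: frequently_close_boundary_point => R n0.
have [n1 h1] := boundary_close_rays (h (R + 2 * D)%N) erefl erefl.
by exists (maxn n0 n1), (maxn n0 n1); split; try apply: h1; lia.
Qed.

Lemma open_ray_value n (g : G) :
  open [set r : geodesic_ray S | ray_val r n = g].
Proof.
pose e := fun c : {ptws nat -> discrete_topology G} =>
  c n : discrete_topology G.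
have ce : continuous e.
  exact: (@proj_continuous nat (fun=> discrete_topology G) n).
exists (e @^-1` [set g]) => //.
by have /continuousP := ce; apply; exact: discrete_open.
Qed.

(** If a ray agrees with [r] at times 0 and [n], late terms of the two have Gromov product at least
    [2 * n] from their common start; the choice of [n] absorbs the move of the base point to 1. *)
Lemma near_ray_close r R :
  \forall r' \near r, boundary_close R (boundary_point r) (boundary_point r').
Proof.
pose n := (R + d 1 (ray_val r 0))%N.
have : nbhs r ([set r' | ray_val r' 0 = ray_val r 0] `&`
               [set r' | ray_val r' n = ray_val r n]).
  by apply: open_nbhs_nbhs; split=> //; apply: openI; exact: open_ray_value.
apply: filterS => r' [r0 rn]; exists r, r'; split=> //; exists n => i j ni nj.
have ab := dT (ray_val r i) (ray_val r n) (ray_val r' j).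
have o1 := gprod_basepoint dC dT (ray_val r 0) 1%g (ray_val r i) (ray_val r' j).
have oa := geodesic_seq_dist (ray_valP r) (leq0n i).
have az := geodesic_seq_dist (ray_valP r) ni.
have ob := geodesic_seq_dist (ray_valP r') (leq0n j).
have zb := geodesic_seq_dist (ray_valP r') nj.
rewrite dC in az; rewrite r0 in ob; rewrite rn in zb.
by rewrite (dC _ 1%g) /gprod in o1; move: o1 ni nj; rewrite /gprod /n; lia.
Qed.

Lemma nbhs_boundary_close xi R : nbhs xi (boundary_close R xi).
Proof.
(* [W] is the interior for the neighborhoods [boundary_close], which is open
   because of [boundary_close_trans]. *)
pose W := [set zeta |
  exists R', boundary_close R' zeta `<=` boundary_close R xi].
rewrite nbhsE; exists W; last first.
  by move=> zeta [R'] /(_ zeta); apply; exact: boundary_close_refl.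
split; last by exists R.
rewrite /open/= /quotient_open openE => r [R' rR'].
apply: filterS (near_ray_close r (R' + 3 * D)) => r' rr'.
exists (R' + D)%N => eta r'eta; apply: rR'.
exact: boundary_close_trans rr' r'eta.
Qed.

End Boundary.

(** * Rays of codes *)

Local Open Scope ring_scope.

Lemma exprn_unbounded (R : realType) (l A : R) : 1 < l -> exists q, A <= l ^+ q.
Proof.
move=> l1; exists (Num.bound (`|A| / (l - 1))).
set n := Num.bound _; have l0 : 0 < l - 1 by rewrite subr_gt0.
have : `|A| / (l - 1) < n%:R by apply: archi_boundP; rewrite divr_ge0// ltW.
rewrite ltr_pdivrMr// => An; apply: le_trans (ler_norm A) _.
have bernoulli k : 1 + k%:R * (l - 1) <= l ^+ k.
  elim: k => [|k IH]; first by rewrite expr0 mul0r addr0.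
  have k0 : (0 : R) <= k%:R by rewrite ler0n.
  have h : 0 <= l by lra.
  rewrite exprSr -natr1; apply: le_trans (ler_wpM2r h IH).
  have : 0 <= k%:R * (l - 1) ^+ 2 by rewrite mulr_ge0 ?sqr_ge0.
  by nra.
by apply: le_trans _ (bernoulli n); rewrite -[leLHS]add0r lerD ?ler01 ?ltW.
Qed.

Section Dynamics.
Variables (R : realType) (M : metricType R) (G : groupType).
Variables (rho : G -> M -> M) (Lam : set M).
Hypothesis rho_action : LHomeo_action rho.
Hypothesis Lam_invariant : invariant_set rho Lam.
Hypothesis Lam_not_isolated : Lam `&` isolated [set: M] = set0.
Variable D : expansion_data M G.
Hypothesis Ddatum : is_expansion_datum rho Lam D.
Local Notation Sigma := (ed_Sigma D).
Local Notation delta := (ed_delta D).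
Local Notation L := (ed_L D).
Local Notation lambda := (ed_lambda D).
Implicit Types (alpha : nat -> ed_index D) (x y p : M).

Lemma action_continuous g : continuous (rho g).
Proof. by have [+ _ _] := rho_action => /(_ g)[[]]. Qed.

Lemma actionM g h x : rho (g * h)%g x = rho g (rho h x).
Proof. by have [_ _] := rho_action. Qed.

Lemma action1 x : rho 1%g x = x.
Proof. by have [_ + _] := rho_action. Qed.

Lemma actionKV g : cancel (rho g^-1%g) (rho g).
Proof. by move=> x; rewrite -actionM mulgV action1. Qed.

Lemma action_in_Lam g x : Lam x -> Lam (rho g x).
Proof. by move=> Lx; rewrite -(Lam_invariant g); exists x. Qed.

Definition code_segment alpha i j : G :=
  (\prod_(i <= t < j) ed_gen D (alpha t))%g.

Lemma code_segmentS alpha i j : (i <= j)%N ->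
  code_segment alpha i j.+1 = (code_segment alpha i j * ed_gen D (alpha j))%g.
Proof. by move=> ij; rewrite /code_segment big_nat_recr. Qed.

Lemma code_ray_segment alpha k : code_ray alpha k = code_segment alpha 0 k.+1.
Proof. by rewrite /code_segment big_mkord. Qed.

Lemma code_rayV_mul alpha i j : (i <= j)%N ->
  ((code_ray alpha i)^-1 * code_ray alpha j)%g = code_segment alpha i.+1 j.+1.
Proof.
move=> ij; rewrite !code_ray_segment /code_segment.
by rewrite [X in (_ * X)%g](big_cat_nat (n := i.+1))//= mulKg.
Qed.

Lemma code_point_segment alpha x i j : (i <= j)%N ->
  code_point rho alpha x j =
    rho (code_segment alpha i j)^-1%g (code_point rho alpha x i).
Proof.
move=> /subnKC<-; elim: (j - i)%N => [|k IH].
  by rewrite addn0 /code_segment big_geq// invg1 action1.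
by rewrite addnS /= IH code_segmentS ?leq_addr// invgM actionM.
Qed.

Lemma code_point_in_Lam alpha x k : Lam x -> Lam (code_point rho alpha x k).
Proof.
move=> Lx; rewrite (code_point_segment alpha x (leq0n k)).
exact: action_in_Lam.
Qed.

Lemma delta_gt0 : 0 < delta. Proof. by have [_ _ _ [[]]] := Ddatum. Qed.

Lemma lambda_gt1 : 1 < lambda.
Proof. by have [_ _ /andP[]] := Ddatum. Qed.

Lemma L_ge0 : 0 <= L.
Proof. by have [_ _ /andP[? ?] _ _] := Ddatum; lra. Qed.

Lemma Sigma_generating : symmetric_generating Sigma.
Proof. by have [_ _ _ _ []] := Ddatum. Qed.

Lemma Sigma_finite : finite_set Sigma.
Proof. exact: (finite_image (ed_gen D) (@finite_finset _ setT)). Qed.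

Lemma gen_expanding i :
  expanding_map_at lambda (ed_cover D i) delta (rho (ed_gen D i)^-1%g).
Proof. by have [_ _ _ _ [/(_ i)[]]] := Ddatum. Qed.

Lemma gen_lipschitz i :
  lipschitz_dist L (open_neighborhood delta Lam) (rho (ed_gen D i)^-1%g).
Proof. by have [_ _ _ _ [/(_ i)[]]] := Ddatum. Qed.

Lemma near_continuous_ball (phi : M -> M) p (e : R) : 0 < e -> continuous phi ->
  \forall y \near p, ball (phi p) e (phi y).
Proof. by move=> e0 cphi; apply: (cphi p); exact: nbhsx_ballx. Qed.

(** The constants multiply as long as the images of [y] stay in the [delta]-balls around the code
    points, which continuity ensures near the [i]-th one. Index 0 is excluded, as a code is
    unconstrained there. *)
Lemma segment_expands alpha x i j : (1 <= i <= j)%N ->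
  is_code rho delta x alpha ->
  \forall y \near code_point rho alpha x i,
    lambda ^+ (j - i) * mdist (code_point rho alpha x i) y <=
    mdist (code_point rho alpha x j) (rho (code_segment alpha i j)^-1%g y).
Proof.
move=> /andP[i1 /subnKC<-] code; rewrite addKn; elim: (j - i)%N => [|k IH].
  near=> y; rewrite addn0 expr0 mul1r /code_segment big_geq// invg1 action1.
  exact: lexx.
set p := code_point _ _ _ i in IH *.
near=> y; rewrite addnS code_segmentS ?leq_addr// invgM actionM /=.
have [exp _] := gen_expanding (alpha (i + k)).
apply: le_trans (exp _ _ _ _).
- rewrite exprS -mulrA; apply: ler_wpM2l.
    by rewrite ltW// (lt_trans ltr01 lambda_gt1).
  by near: y.
- by apply: (code (i + k)%N); [lia|apply: ballxx; exact: delta_gt0].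
- apply: (code (i + k)%N); first by lia.
  rewrite (code_point_segment _ _ (leq_addr k i)).
  by near: y; apply: near_continuous_ball delta_gt0 _; exact: action_continuous.
Unshelve. all: by end_near. Qed.

(** Lipschitz bounds compose along a shortest word. They hold near [Lam], whose invariance keeps the
    images of [p] inside it. *)
Lemma word_lipschitz g p : Lam p ->
  \forall y \near p,
    mdist (rho g^-1%g p) (rho g^-1%g y) <= L ^+ word_length Sigma g * mdist p y.
Proof.
have [w [<- wS ->]] := word_length_word Sigma_generating g.
have L0 := L_ge0.
elim: w wS p => [|s w IH] wS p Lp.
  by near=> y; rewrite big_nil invg1 !action1 /= expr0 mul1r.
have [i _ si] := wS s (mem_head _ _).
have {}IH := IH (fun t tw => wS t (@mem_behead _ (s :: w) t tw))
  (rho s^-1%g p) (action_in_Lam _ Lp).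
near=> y; rewrite big_cons invgM !actionM /= exprSr -mulrA.
have pN : open_neighborhood delta Lam p.
  by exists p => //; apply: ballxx; exact: delta_gt0.
have yN : open_neighborhood delta Lam y.
  by exists p => //; near: y; apply: nbhsx_ballx; exact: delta_gt0.
have step : mdist (rho s^-1%g p) (rho s^-1%g y) <= L * mdist p y.
  by rewrite -si; exact: gen_lipschitz.
apply: le_trans _ (ler_wpM2l (exprn_ge0 _ L0) step); near: y.
exact: (@action_continuous s^-1%g p _ IH).
Unshelve. all: by end_near. Qed.

(* Compare both distortion estimates on a point close to, but different from,
   the [i]-th code point, which is not isolated. *)
Lemma segment_length_ge alpha x i j : Lam x -> (1 <= i <= j)%N ->
  is_code rho delta x alpha ->
  lambda ^+ (j - i) <= L ^+ word_length Sigma (code_segment alpha i j).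
Proof.
move=> Lx ij code.
set p := code_point rho alpha x i; set g := code_segment _ _ _.
have Lp : Lam p by exact: code_point_in_Lam.
have [y [py1 py2 py]] : exists y, [/\
    lambda ^+ (j - i) * mdist p y <= mdist (rho g^-1%g p) (rho g^-1%g y),
    mdist (rho g^-1%g p) (rho g^-1%g y) <=
      L ^+ word_length Sigma g * mdist p y &
    p != y].
  apply: contrapT => /forallNP nV.
  have : (Lam `&` isolated [set: M]) p; last by rewrite Lam_not_isolated.
  split=> //; split; first exact/mem_set.
  have e1 := segment_expands ij code; have e2 := word_lipschitz g Lp.
  have ep : rho g^-1%g p = code_point rho alpha x j.
    by rewrite -code_point_segment//; case/andP: ij.
  eexists; first exact: (filterI e1 e2).
  apply/seteqP; split=> [y [[/= h1 h2] _]|_ ->]; last first.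
    split=> //; split; first exact: (nbhs_singleton e1).
    exact: (nbhs_singleton e2).
  apply/eqP; rewrite eq_sym; apply/negPn/negP => py.
  by apply: (nV y); split=> //; rewrite ep.
by have := le_trans py1 py2; rewrite ler_pM2r// mdist_gt0.
Qed.

Lemma code_ray_quasigeodesic : exists2 q, (0 < q)%N & forall alpha x, Lam x ->
  is_code rho delta x alpha ->
  quasigeodesic (word_dist Sigma) 1 q (code_ray alpha).
Proof.
(* With [L <= lambda ^+ q], the estimate of [segment_length_ge] becomes a comparison of exponents of
   [lambda]. *)
have [q Lq] := exprn_unbounded L lambda_gt1.
exists q.+1 => // alpha x Lx code i j ij.
rewrite /word_dist code_rayV_mul// mul1n; split.
  apply: word_length_le.
  exists [seq ed_gen D (alpha t) | t <- index_iota i.+1 j.+1]; split.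
  - by rewrite size_map size_iota subSS.
  - by move=> s /mapP[t _ ->]; exists (alpha t).
  - by rewrite big_map.
have := segment_length_ge Lx (_ : 1 <= i.+1 <= j.+1)%N code; rewrite subSS.
move=> /(_ ij) h; set l := word_length _ _ in h *.
have l1 := lambda_gt1.
rewrite -(ler_eXn2l l1) mulnC; apply: le_trans h _.
have L0 := L_ge0.
rewrite mulnC exprM lerXn2r// ?nnegrE ?exprn_ge0//; last by rewrite exprS; nra.
by lra.
Qed.

(** Pull the ball back letter by letter with the second half of the expanding property. The radius
    shrinks by [lambda] each time and stays at most [delta], so the code keeps the ball in the
    cover. *)
Lemma segment_ball alpha x i j (eta : R) : (1 <= i <= j)%N ->
  is_code rho delta x alpha -> 0 < eta <= delta ->
  ball (code_point rho alpha x j) eta `<=`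
  rho (code_segment alpha i j)^-1%g @`
    ball (code_point rho alpha x i) (eta / lambda ^+ (j - i)).
Proof.
move=> /andP[i1 /subnKC<-] code; rewrite addKn.
have l1 := lambda_gt1; have l0 : 0 < lambda by lra.
elim: (j - i)%N eta => [|k IH] eta /andP[e0 ed] z.
  rewrite addn0 expr0 divr1 /code_segment big_geq// invg1 => zp.
  by exists z; rewrite ?action1.
rewrite addnS /= => zp.
have el : eta / lambda <= eta by rewrite ler_pdivrMr//; nra.
have [_ exp] := gen_expanding (alpha (i + k)).
have /exp : 0 < eta / lambda <= delta by rewrite divr_gt0//= (le_trans el ed).
move=> /(_ (code_point rho alpha x (i + k))).
rewrite mulrCA divff ?gt_eqF// mulr1 => /(_ _ _ zp)[].
  apply: subset_trans (code (i + k)%N _); last by lia.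
  by apply: le_ball; exact: le_trans el ed.
move=> z' zz' <-.
have [|y yp <-] := IH (eta / lambda) _ z' zz'.
  by rewrite divr_gt0//= (le_trans el ed).
exists y; last by rewrite code_segmentS ?leq_addr// invgM actionM.
by rewrite exprS invfM mulrA.
Qed.

Lemma code_ray_ball alpha x (V : set M) :
  is_code rho delta x alpha -> nbhs x V ->
  exists k0, forall k, (k0 <= k)%N ->
    rho (code_ray alpha k) @` ball (code_point rho alpha x k.+1) delta `<=` V.
Proof.
move=> code xV; have l1 := lambda_gt1.
(* The code condition is silent at index 0, so the first letter [s] is handled by continuity and the
   contraction takes place around [p1]. *)
set s := ed_gen D (alpha 0%N); set p1 := code_point rho alpha x 1.
have : nbhs p1 (rho s @^-1` V).
  by apply: (action_continuous (g := s)); rewrite /p1 /= actionKV.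
move=> /nbhs_ballP[e /= e0 eV].
have [q hq] := exprn_unbounded (delta / e) l1.
exists q => k qk _ [z zk <-].
have [|y yp <-] := @segment_ball alpha x 1 k.+1 delta ltac:(lia) code _ z zk.
  by rewrite delta_gt0/=.
have -> : code_ray alpha k = (s * code_segment alpha 1 k.+1)%g.
  by rewrite code_ray_segment /code_segment big_ltn.
rewrite actionM actionKV; apply: eV; apply: le_ball yp.
rewrite subSS subn0 ler_pdivrMr ?exprn_gt0//; last by lra.
rewrite mulrC -ler_pdivrMr//; apply: le_trans hq _.
by apply: ler_weXn2l => //; exact: ltW.
Qed.

Lemma code_exists x : Lam x -> exists alpha, is_code rho delta x alpha.
Proof.
have ball_in p : Lam p -> exists i, ball p delta `<=` ed_cover D i.
  move=> Lp; apply: contrapT => /forallNP nU.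
  have [_ _ _ [_ dsup] _] := Ddatum.
  (* [delta] may be the supremum of the Lebesgue numbers without being one of
     them; the index set being finite, a failure at [delta] would persist at
     some smaller radius. *)
  have far (i : ed_index D) : exists2 y, ball p delta y & ~ ed_cover D i y.
    by have /existsNP[y /not_implyP[]] := nU i; exists y.
  pose y i := s2val (cid2 (far i)).
  have yb i : ball p delta (y i) := s2valP (cid2 (far i)).
  have yU i : ~ ed_cover D i (y i) := s2valP' (cid2 (far i)).
  have [e ed hy] : exists2 e : R, e < delta & forall i, mdist p (y i) < e.
    have lt i : mdist p (y i) < delta by have := yb i; rewrite ballEmdist.
    exists (\big[Num.max/0]_i ((mdist p (y i) + delta) / 2)).
      apply: bigmax_lt; first exact: delta_gt0.
      by move=> i _; have := lt i; lra.
    move=> i; apply: lt_le_trans (le_bigmax _ _ i).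
    by have := lt i; lra.
  have : (e%:E < sup_lebesgue Lam (ed_cover D))%E.
    by apply: lt_le_trans dsup; rewrite lte_fin.
  move=> /ereal_sup_gt[_ [e' [e'0 e'P] <-]]; rewrite lte_fin => ee'.
  have [i iU] := e'P p Lp; apply: (yU i); apply: iU.
  by rewrite ballEmdist /=; apply: lt_trans ee'.
move=> Lx.
(* [x0] is a default index for points outside [Lam]. *)
have [x0 _] := ball_in x Lx.
have choice_ p : exists i, Lam p -> ball p delta `<=` ed_cover D i.
  by have [/ball_in[i iU]|nL] := pselect (Lam p); [exists i|exists x0].
pose F p := sval (cid (choice_ p)).
have FP p : Lam p -> ball p delta `<=` ed_cover D (F p) :=
  svalP (cid (choice_ p)).
pose pt := fix pt k :=
  if k is k'.+1 then rho (ed_gen D (F (pt k')))^-1%g (pt k') else x.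
exists (F \o pt) => k _.
have -> : code_point rho (F \o pt) x k = pt k by elim: k => //= k ->.
by apply: FP; elim: k => //= k IH; exact: action_in_Lam.
Qed.

End Dynamics.

(** * Convergence of rays to the values of f *)

Section Postal.
Variables (R : realType) (G : groupType) (S : generating_set G).
Variables (M : metricType R) (rho : G -> M -> M) (Lam : set M).
Variable (f : M -> boundary S) (K : nat).
Local Notation d := (word_dist S).
Local Notation gp := (gprod d).
Hypothesis hypS : forall o x y z : G,
  (minn (gp o x y) (gp o y z) <= gp o x z + K)%N.
Hypothesis rho_action : LHomeo_action rho.
Hypothesis Lam_compact : compact Lam.
Hypothesis Lam_invariant : invariant_set rho Lam.
Hypothesis Lam_not_isolated : Lam `&` isolated [set: M] = set0.
Hypothesis f_equivariant : equivariant_on rho Lam f.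
Hypothesis f_continuous : {within Lam, continuous f}.
Hypothesis f_nowhere_constant : nowhere_constant_on Lam f.

Let genS : symmetric_generating S := gens_generating S.
Let dxx := @word_distxx G S.
Let dC := word_distC genS.
Let dT x y z := word_dist_triangle genS y x z.
Let geod := word_dist_geodesic genS.

(** Near each point [f] takes two distinct values, which fail to be close at some level. Halving the
    radius lets the same two points serve all nearby [p], and compactness makes the level
    uniform. *)
Lemma image_separated (e : R) : 0 < e -> exists C, forall p, Lam p ->
  exists q q',
    [/\ Lam q, Lam q', ball p e q, ball p e q' &
        ~ boundary_close C (f q) (f q')].
Proof.
move=> e0; have /compact_near_coveringP := Lam_compact.
pose P C p := exists q q',
  [/\ Lam q, Lam q', ball p e q, ball p e q' & ~ boundary_close C (f q) (f q')].
move=> /(_ nat \oo P _)[]; last first.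
  by move=> C _ /(_ C (leqnn C)) h; exists C => p Lp; exact: h.
move=> x Lx; have e20 : 0 < e / 2 by rewrite divr_gt0.
have [q [q' [Lq Lq' xq xq' fqq']]] : exists q q',
    [/\ Lam q, Lam q', ball x (e / 2) q, ball x (e / 2) q' & f q <> f q'].
  apply: contrapT => nV; set U := (ball x (e / 2))^°.
  have Ux : (Lam `&` U) x by split=> //; exact: (nbhsx_ballx x _ e20).
  apply: (@f_nowhere_constant U (@open_interior _ _) _ (f x)).
    by exists x.
  apply/seteqP; split=> [_ [y [Ly Uy] <-]|_ ->]; last by exists x.
  apply: contrapT => fyx; apply: nV; exists y, x; split=> //.
    exact: interior_subset Uy.
  exact: ballxx.
have [C0 nC0] : exists C0, ~ boundary_close C0 (f q) (f q').
  apply: contrapT => nV; apply: fqq'; apply: (boundary_close_inj hypS) => C.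
  by apply: contrapT => nC; apply: nV; exists C.
exists (ball x (e / 2), [set C | (C0 <= C)%N]) => /=.
  by split; [exact: nbhsx_ballx|exists C0].
move=> [p C] [/= xp C0C]; exists q, q'; split=> //.
- by rewrite (splitr e); apply: ball_triangle xq; exact: ball_sym.
- by rewrite (splitr e); apply: ball_triangle xq'; exact: ball_sym.
- by move=> /(boundary_close_le C0C).
Qed.

Lemma gprod_wordMl g o x y : gp (g * o)%g (g * x)%g (g * y)%g = gp o x y.
Proof. by rewrite /gprod !word_distMl. Qed.

Definition converges_to (c : nat -> G) (r : geodesic_ray S) := forall n : nat,
  exists k0, forall k, (k0 <= k)%N ->
    exists n0, forall m, (n0 <= m)%N -> (n <= gp 1%g (c k) (ray_val r m))%N.

Lemma converges_to_frequently_close c r :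
  converges_to c r -> frequently_close d 1%g c (ray_val r).
Proof.
move=> cr n n0; have [k0 /(_ (maxn k0 n0) (leq_maxl _ _))[n1 h]] := cr n.
exists (maxn k0 n0), (maxn n0 n1); rewrite leq_maxr leq_maxl; split=> //.
by apply: h; exact: leq_maxr.
Qed.

Lemma converge_together c c' r : converges_to c r -> converges_to c' r ->
  frequently_close d 1%g c c'.
Proof.
move=> cr c'r n n0.
have [k0 /(_ (maxn k0 n0) (leq_maxl _ _))[n1 h1]] := cr (n + K)%N.
have [k1 /(_ (maxn k1 n0) (leq_maxl _ _))[n2 h2]] := c'r (n + K)%N.
exists (maxn k0 n0), (maxn k1 n0); rewrite !leq_maxr; split=> //.
have := h1 (maxn n1 n2) (leq_maxl _ _); have := h2 (maxn n1 n2) (leq_maxr _ _).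
set z := ray_val r _; rewrite [gp _ (c' _) z](gprodC dC).
by have := hypS 1%g (c (maxn k0 n0)) z (c' (maxn k1 n0)); lia.
Qed.

Section Datum.
Variable D : expansion_data M G.
Hypothesis Ddatum : is_expansion_datum rho Lam D.
Local Notation Sigma := (ed_Sigma D).
Local Notation delta := (ed_delta D).

Lemma code_ray_converges (alpha : nat -> ed_index D) x r : Lam x ->
  is_code rho delta x alpha -> boundary_point r = f x ->
  converges_to (code_ray alpha) r.
Proof.
move=> Lx code rx n.
have [C sepC] := image_separated (delta_gt0 Ddatum).
(* [2 * K] pays for two uses of the hyperbolic inequality at the end, and [C] for
   [gprod_between]. *)
pose n1 := (n + 2 * K + C)%N.
have /subspace_continuousP fc := f_continuous.
(* The extra [2 * K] is lost in [boundary_close_rays], on passing to the chosen representatives. *)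
have xV := fc x Lx _ (nbhs_boundary_close hypS (f x) (n1 + 2 * K)%N).
have [k0 k0P] := code_ray_ball rho_action Ddatum code xV.
exists k0 => k /k0P kV; set g := code_ray alpha k in kV *.
have Lpk := code_point_in_Lam rho_action Lam_invariant alpha k.+1 Lx.
have [q [q' [Lq Lq' pq pq' nC]]] := sepC _ Lpk.
have [a aq] := boundary_pointP (f q); have [b bq'] := boundary_pointP (f q').
(* [g] moves [u] into the neighborhood of [x] given by continuity; by equivariance [translate g v]
   represents the value of [f] there. *)
have translated u v : Lam u -> ball (code_point rho alpha x k.+1) delta u ->
    boundary_point v = f u ->
    eventually_gprod d n1 1%g (ray_val r) (ray_val (translate g v)).
  move=> Lu pu vu; have Lgu := action_in_Lam Lam_invariant g Lu.
  have vgu : boundary_point (translate g v) = f (rho g u).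
    by rewrite f_equivariant// -vu boundary_actE.
  exact: (boundary_close_rays hypS (kV _ (imageP _ pu) Lgu) rx vgu).
have [na ha] := translated q a Lq pq aq.
have [nb hb] := translated q' b Lq' pq' bq'.
pose n2 := maxn na nb.
have [i [j [ni nj ij]]] : exists i j, [/\ (n2 <= i)%N, (n2 <= j)%N &
    (gp 1%g (ray_val a i) (ray_val b j) <= C)%N].
  apply: contrapT => nV; apply: nC; exists a, b; split=> //.
  exists n2 => i j ni nj; rewrite leqNgt; apply/negP => ij.
  by apply: nV; exists i, j; split=> //; lia.
set u := (g * ray_val a i)%g; set v := (g * ray_val b j)%g.
have au m : (na <= m)%N -> (n1 <= gp 1%g (ray_val r m) u)%N.
  by move=> nm; apply: (ha m i nm); lia.
have bv m : (nb <= m)%N -> (n1 <= gp 1%g (ray_val r m) v)%N.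
  by move=> nm; apply: (hb m j nm); lia.
(* Left invariance moves the bounded product to the base point [g]. From 1, both [u] and [v] lie in
   the direction of [r], hence so does [g]. *)
have guv : (gp g u v <= C)%N by rewrite -{1}(mulg1 g) gprod_wordMl.
have h1 := gprod_between dC dT 1%g guv.
have h2 := hypS 1%g u (ray_val r n2) v.
have h3 := au n2 ltac:(lia); have h4 := bv n2 ltac:(lia).
exists na => m nm; have h5 := au m nm; have h6 := hypS 1%g g u (ray_val r m).
rewrite (gprodC dC 1%g u) in h2; rewrite (gprodC dC 1%g _ u) in h5.
by move: h1 h2 h3 h4 h5 h6; rewrite /n1; lia.
Qed.

Lemma code_ray_word_quasigeodesic : exists B Q, [/\ (0 < B)%N, (0 < Q)%N,
  forall g, (word_length S g <= B * word_length Sigma g)%N,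
  forall g, (word_length Sigma g <= Q * word_length S g)%N &
  forall (alpha : nat -> ed_index D) x, Lam x -> is_code rho delta x alpha ->
    quasigeodesic d B Q (code_ray alpha)].
Proof.
have genSigma := Sigma_generating Ddatum.
have [B B0 BP] := word_length_bound genSigma genS (@Sigma_finite _ _ _ D).
have [A A0 AP] := word_length_bound genS genSigma (@gens_finite G S).
have [q q0 qP] :=
  code_ray_quasigeodesic rho_action Lam_invariant Lam_not_isolated Ddatum.
exists B, (q * A)%N; split=> //; first by rewrite muln_gt0 q0.
  by move=> g; apply: leq_trans (AP g) _; rewrite leq_mul2r leq_pmull ?orbT.
move=> alpha x Lx code i j ij; have [h1 h2] := qP alpha x Lx code i j ij.
rewrite mul1n in h1; split.
  by apply: leq_trans (BP _) _; rewrite leq_mul2l h1 orbT.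
by apply: leq_trans h2 _; rewrite -mulnA leq_mul2l; apply/orP; right; exact: AP.
Qed.

Lemma code_ray_represents (alpha : nat -> ed_index D) x : Lam x ->
  is_code rho delta x alpha -> represents (code_ray alpha) (f x).
Proof.
move=> Lx code; have [r rx] := boundary_pointP (f x); exists r; split=> //.
have [B [Q [B0 Q0 _ _ /(_ alpha x Lx code) qc]]] := code_ray_word_quasigeodesic.
apply: (frequently_close_hausdorff hypS qc); last first.
  by apply: converges_to_frequently_close; exact: code_ray_converges code rx.
by apply: geodesic_seq_quasigeodesic => //; exact: ray_valP.
Qed.

Lemma code_rays_hausdorff : exists2 N, (1 <= N)%N &
  forall x, Lam x -> forall c c',
  Ray rho D delta x c -> Ray rho D delta x c' ->
  hausdorff_le Sigma N (range c) (range c').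
Proof.
have [B [Q [B0 Q0 BP QP qc]]] := code_ray_word_quasigeodesic.
(* [2 * B] bounds the distance between initial terms, which are single letters of [Sigma]; so [N] is
   common to all codes and all [x]. *)
have [N NP] := quasigeodesic_fellow dxx dC dT hypS geod B Q (2 * B) 1%g.
(* [Q] converts back to distances in [Sigma]; the successor makes the bound positive. *)
exists (Q * N).+1 => // x Lx _ _ [a ac ->] [b bc ->].
have dist0 (u v : nat -> ed_index D) :
    (d (code_ray u 0) (code_ray v 0) <= 2 * B)%N.
  have one (w : nat -> ed_index D) : (word_length S (code_ray w 0) <= B)%N.
    rewrite -[leqRHS]muln1; apply: leq_trans (BP _) _; rewrite leq_mul2l.
    apply/orP; right; apply: word_length_le; apply: word_product_gen.
    by exists (w 0%N) => //; rewrite /code_ray big_ord_recl big_ord0 mulg1.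
  apply: leq_trans (word_lengthM genS _ _) _.
  by rewrite (word_lengthV genS) mul2n -addnn leq_add.
have [r rx] := boundary_pointP (f x).
have fellow (u v : nat -> ed_index D) :
    is_code rho delta x u -> is_code rho delta x v -> forall k, exists j,
    (word_dist Sigma (code_ray u k) (code_ray v j) <= (Q * N).+1)%N.
  move=> uc vc k.
  have [|j jN] := NP _ _ (qc u x Lx uc) (qc v x Lx vc) (dist0 u v) _ k.
    apply: (@converge_together _ _ r); exact: code_ray_converges rx.
  exists j; apply: leqW; apply: leq_trans (QP _) _.
  by rewrite leq_mul2l; apply/orP; right.
by apply: hausdorff_le_fellow; [exact: fellow ac bc|exact: fellow bc ac].
Qed.

Lemma expansion_datum_is_postal_map : is_postal_map rho Lam D f.
Proof.
move=> x Lx; split.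
  have [alpha code] := code_exists Lam_invariant Ddatum Lx.
  by exists (code_ray alpha), alpha.
by move=> _ [alpha code ->]; exact: code_ray_represents.
Qed.

End Datum.
End Postal.

(** * From S-hyperbolicity to meandering hyperbolicity *)

Section Shrink.
Variables (R : realType) (M : metricType R) (G : groupType).
Variables (rho : G -> M -> M) (Lam : set M).

Definition shrink_delta (D : expansion_data M G) (e : R) : expansion_data M G :=
  @ExpansionData R M G (ed_index D) (@ed_cover R M G D) (@ed_gen R M G D)
    e (ed_L D) (ed_lambda D).

Lemma shrink_delta_datum D e : is_expansion_datum rho Lam D ->
  0 < e <= ed_delta D -> is_expansion_datum rho Lam (shrink_delta D e).
Proof.
move=> [oU cU Ll [d0 dsup] [act gen]] /andP[e0 ed]; split=> //.
  by split=> //=; apply: le_trans dsup; rewrite lee_fin.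
split=> // i /=; have [lip [exp expb]] := act i; split.
  move=> x y [x' Lx' xx'] [y' Ly' yy'].
  apply: lip; first by exists x' => //; exact: le_ball xx'.
  by exists y' => //; exact: le_ball yy'.
by split=> // x eta /andP[eta0 etae]; apply: expb; rewrite eta0 (le_trans etae).
Qed.

(** The order on data demands a strictly smaller radius, hence the half. Rays for the larger radius
    are rays for the smaller one, and a single step with both index sets equal to [setT] links two
    rays of the same point. *)
Lemma S_hyperbolic_meandering D N : S_hyperbolic_datum rho Lam D N ->
  meandering_hyperbolic_datum rho Lam D (shrink_delta D (ed_delta D / 2)) N.
Proof.
move=> [Dd N1 hN]; have d0 := delta_gt0 Dd.
have h : ed_delta D / 2 < ed_delta D by lra.
split=> //.
- by apply: shrink_delta_datum => //; rewrite divr_gt0//= ltW.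
- by split=> //=; exists id => // i; split.
- have sub x c : Ray rho D (ed_delta D) x c ->
      Ray rho (shrink_delta D (ed_delta D / 2)) (ed_delta D / 2) x c.
    move=> [alpha code ->]; exists alpha => // k k1.
    have same :
        @code_point _ _ _ rho (shrink_delta D (ed_delta D / 2)) alpha x k =
        @code_point _ _ _ rho D alpha x k by elim: k {k1} => //= k ->.
    rewrite same.
    by apply: subset_trans (code k k1); apply: le_ball; exact: ltW.
  move=> x Lx c c' cR c'R; split; [exact: sub|exact: sub|].
  apply: rst_step; split; [exact: sub|exact: sub|].
  exists setT, setT; split; [exact: infinite_nat|exact: infinite_nat|].
  exact: (hN x Lx c c' cR c'R).
Qed.

End Shrink.

Theorem theorem1p5 (R : realType) (G : groupType) (S : generating_set G)
    (M : metricType R) (rho : G -> M -> M) (Lam : set M) (f : M -> boundary S)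
    (G_hyperbolic : word_hyperbolic S)
    (G_non_elementary : non_elementary G)
    (M_proper : proper_space M)
    (M_geodesic : geodesic_space M)
    (rho_action : LHomeo_action rho)
    (Lam_nonempty : Lam !=set0)
    (Lam_compact : compact Lam)
    (Lam_invariant : invariant_set rho Lam)
    (Lam_not_isolated : Lam `&` isolated [set: M] = set0)
    (rho_expanding : expanding_at rho Lam)
    (f_equivariant : equivariant_on rho Lam f)
    (f_continuous : {within Lam, continuous f})
    (f_nowhere_constant : nowhere_constant_on Lam f) :
  [/\ S_hyperbolic_at rho Lam,
      meandering_hyperbolic_at rho Lam &
      forall (D0 D : expansion_data M G) (N : nat),
        meandering_hyperbolic_datum rho Lam D0 D N ->
        is_postal_map rho Lam D0 f].
Proof.
have [K hypK] := word_hyperbolic_gprod (gens_generating S) G_hyperbolic.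
have [D Dd] := rho_expanding.
have [N N1 hN] := code_rays_hausdorff hypK rho_action Lam_compact Lam_invariant
  Lam_not_isolated f_equivariant f_continuous f_nowhere_constant Dd.
have SD : S_hyperbolic_datum rho Lam D N by split.
split; first by exists D, N.
- by eexists; eexists; eexists; exact: S_hyperbolic_meandering SD.
(* For every expansion datum the rays at [x] represent [f x]; this is applied to the given [D0], not
   to the [D] chosen above. *)
- move=> D0 D' N' [D0d _ _ _ _].
  exact: (expansion_datum_is_postal_map hypK).
Qed.
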